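(* Let $\sigma$ be a signature, let $\mathcal{A}$ and $\mathcal{B}$ be $\sigma$-structures with domains $A$ and $B$, where $|A|>1$, and let $u:\mathcal{A}\hookrightarrow\mathcal{B}$ be an embedding. Let $I$ and $J$ be sets, let $h:J\to I$ be a mapping, and let $\mathcal{U}_I$ and $\mathcal{U}_J$ be ultrafilters over $I$ and $J$ respectively. For each $f\in A^I$ let $w(f)\in B^J$ be the (unique) function such that, for every $a\in A$, $$\{j\in J\mid w(f)(j)=u(a)\}=h^{-1}[\{i\in I\mid f(i)=a\}].$$ Define $e:\mathcal{A}^I/\mathcal{U}_I\to\mathcal{B}^J/\mathcal{U}_J$ by $[f]_{\mathcal{U}_I}\mapsto[w(f)]_{\mathcal{U}_J}$. Then $e$ is a (well-defined) embedding if and only if for every $X\subseteq I$: $X\in\mathcal{U}_I\Leftrightarrow h^{-1}[X]\in\mathcal{U}_J$.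
   Context: Structures may have partial operations. $A^I$ is the set of all functions $I\to A$, $[f]_{\mathcal{U}}$ is the equivalence class of $f$ modulo the ultrafilter $\mathcal{U}$, and $\mathcal{A}^I/\mathcal{U}$ is the ultrapower: $\mathrm{F}([f_1]_{\mathcal{U}},\dots,[f_n]_{\mathcal{U}})=[g]_{\mathcal{U}}$ holds iff $\{i\in I\mid \mathrm{F}^{\mathcal{A}}(f_1(i),\dots,f_n(i))\text{ is defined and equals }g(i)\}\in\mathcal{U}$; likewise for relations; constants are interpreted by the classes of constant functions. An embedding is an injective map that preserves constants, preserves operations (if $\mathrm{F}(a_1,\dots,a_n)=b$ in the source then the same holds for the images in the target), and preserves and reflects relations. *)

(* Defs.v *)
From HB Require Import structures.
From mathcomp Require Import all_boot.
From mathcomp Require Import boolp classical_sets filter.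

Set Implicit Arguments.
Unset Strict Implicit.
Unset Printing Implicit Defensive.

Local Open Scope classical_set_scope.
Local Open Scope quotient_scope.

Record signature := Signature {
  sig_const : Type;
  sig_op : Type;
  sig_rel : Type;
  op_arity : sig_op -> nat;
  rel_arity : sig_rel -> nat }.

(* Operations are partial and given by their graphs: [op_graph F a b] means
   that F(a_1, ..., a_n) is defined and equal to b. *)
Record structure (s : signature) := Structure {
  dom :> Type;
  const : sig_const s -> dom;
  op_graph : forall F : sig_op s, ('I_(op_arity F) -> dom) -> dom -> Prop;
  op_graph_fun : forall F a b c, @op_graph F a b -> @op_graph F a c -> b = c;
  rel_holds : forall R : sig_rel s, ('I_(rel_arity R) -> dom) -> Prop }.

Arguments const {s} _ _.
Arguments op_graph {s} _ _ _ _.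
Arguments rel_holds {s} _ _ _.

Definition is_embedding (s : signature) (A B : structure s) (u : A -> B) :=
  [/\ injective u,
      forall c, u (const A c) = const B c,
      forall F a b, op_graph A F a b -> op_graph B F (u \o a) (u b) &
      forall R a, rel_holds A R a <-> rel_holds B R (u \o a)].

Section Ultrapower.
Variables (s : signature) (A : structure s) (I : Type) (U : set_system I).
Hypothesis UU : UltraFilter U.

#[local] Instance proper_UU : ProperFilter U := ultra_proper.

Definition ultra_eq (f g : {classic I -> A}) : bool :=
  `[< U [set i | f i = g i] >].

Lemma ultra_eq_refl : reflexive ultra_eq.
Proof. by move=> f; apply/asboolP; apply: filterE. Qed.

Lemma ultra_eq_sym : symmetric ultra_eq.
Proof.
move=> f g; apply/asboolP/asboolP; apply: filterS => i /= e; exact: esym.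
Qed.

Lemma ultra_eq_trans : transitive ultra_eq.
Proof.
move=> g f k /asboolP fg /asboolP gk; apply/asboolP.
by apply: filterS2 fg gk => i /= -> ->.
Qed.

Canonical ultra_eq_equiv :=
  EquivRel ultra_eq ultra_eq_refl ultra_eq_sym ultra_eq_trans.

Definition ultrapower_dom := {eq_quot ultra_eq_equiv}.

Definition ultra_class (f : I -> A) : ultrapower_dom :=
  \pi_ultrapower_dom (f : {classic I -> A}).

Definition ultra_repr (x : ultrapower_dom) : I -> A := repr x.

Lemma ultra_classP f g :
  ultra_class f = ultra_class g <-> U [set i | f i = g i].
Proof.
split=> [/eqmodP /asboolP // | fg]; by apply/eqmodP/asboolP.
Qed.

Lemma ultra_reprK x : ultra_class (ultra_repr x) = x.
Proof. exact: reprK. Qed.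

Lemma ultra_class_repr f : U [set i | ultra_repr (ultra_class f) i = f i].
Proof. by apply/ultra_classP; rewrite ultra_reprK. Qed.

Lemma ultra_classes_repr n (f : 'I_n -> I -> A) :
  U [set i | (fun k => ultra_repr (ultra_class (f k)) i) = f^~ i].
Proof.
have : U [set i | forall k, ultra_repr (ultra_class (f k)) i = f k i].
  exact: filter_forall (fun k => ultra_class_repr (f k)).
by apply: filterS => i fi; apply/funext.
Qed.

(* Evaluated on chosen representatives; [ultra_opE] and [ultra_relE] show that
   any representatives give the same result. *)
Definition ultra_op (F : sig_op s) (x : 'I_(op_arity F) -> ultrapower_dom)
    (y : ultrapower_dom) : Prop :=
  U [set i | op_graph A F (fun k => ultra_repr (x k) i) (ultra_repr y i)].

Definition ultra_rel (R : sig_rel s) (x : 'I_(rel_arity R) -> ultrapower_dom) :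
    Prop :=
  U [set i | rel_holds A R (fun k => ultra_repr (x k) i)].

Lemma ultra_opE F (f : 'I_(op_arity F) -> I -> A) (g : I -> A) :
  ultra_op (fun k => ultra_class (f k)) (ultra_class g) <->
  U [set i | op_graph A F (f^~ i) (g i)].
Proof.
have fE := ultra_classes_repr f; have gE := ultra_class_repr g.
split=> h; apply: filterS3 fE gE h => i /= -> -> //.
Qed.

Lemma ultra_relE R (f : 'I_(rel_arity R) -> I -> A) :
  ultra_rel (fun k => ultra_class (f k)) <->
  U [set i | rel_holds A R (f^~ i)].
Proof.
have fE := ultra_classes_repr f.
split=> h; apply: filterS2 fE h => i /= -> //.
Qed.

Lemma ultra_op_fun F (x : 'I_(op_arity F) -> ultrapower_dom) y z :
  ultra_op x y -> ultra_op x z -> y = z.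
Proof.
move=> xy xz; rewrite -(ultra_reprK y) -(ultra_reprK z); apply/ultra_classP.
by apply: filterS2 xy xz => i; apply: op_graph_fun.
Qed.

Definition ultrapower : structure s :=
  @Structure s ultrapower_dom (fun c => ultra_class (fun=> const A c))
    ultra_op ultra_op_fun ultra_rel.

End Ultrapower.

(* The condition defining g = w(f). *)
Definition transfer_spec (A B I J : Type) (u : A -> B) (h : J -> I)
    (f : I -> A) (g : J -> B) : Prop :=
  forall a, [set j | g j = u a] = h @^-1` [set i | f i = a].

(* Main.v *)
Require Import Defs.
From mathcomp Require Import all_boot.
From mathcomp Require Import boolp classical_sets filter.
Local Open Scope classical_set_scope.

Set Implicit Arguments.
Unset Strict Implicit.

(** The condition defining [w(f)] says, pointwise, that [w(f) j = u a] exactly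
    when [f (h j) = a]; for injective [u] its only solution is
    [w(f) = u \o f \o h] ([transfer_specE]).  Thus a set of indices [j] defined
    by a condition on values of functions [w(f)] is the preimage under [h] of
    the set of indices [i] defined by the corresponding condition on the values
    of the functions [f], as soon as [u] preserves and reflects that condition.
    For the graph of an operation, which [u] only preserves, the preimage is
    contained in the set of such [j], and upward closure of the filter is enough.

    If membership in the ultrafilters is preserved and reflected by preimage
    under [h], then every clause in the definition of an embedding passes from
    [u] to the ultrapowers by reading the clause on index sets
    ([transfer_embedding]); preservation and reflection of equality make the
    map well defined and injective.

    Conversely, two distinct points of [A] make every [X] the equalizer of a
    two-valued function and a constant function.  Then [X] is large iff their
    classes are equal, iff the images of these classes under the injective map
    [e] are equal, iff the preimage of [X] is large
    ([transfer_injective_filter]). *)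

Lemma transfer_specE (A B I J : Type) (u : A -> B) (h : J -> I)
    (f : I -> A) (g : J -> B) :
  injective u -> transfer_spec u h f g <-> g = u \o f \o h.
Proof.
move=> u_inj; split=> [fg | -> a].
  apply/funext => j /=.
  suff : [set j' | g j' = u (f (h j))] j by [].
  by rewrite fg.
by apply/seteqP; split=> j /= => [/u_inj | ->].
Qed.

Section Transfer.
Variables (s : signature) (A B : structure s) (u : A -> B).
Variables (I J : Type) (h : J -> I).
Variables (UI : set_system I) (UI_ultra : UltraFilter UI).
Variables (UJ : set_system J) (UJ_ultra : UltraFilter UJ).

Local Notation AI := (ultrapower A UI_ultra).
Local Notation BJ := (ultrapower B UJ_ultra).
Local Notation clI := (@ultra_class s A I UI UI_ultra).
Local Notation clJ := (@ultra_class s B J UJ UJ_ultra).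

(** Index sets of equalities correspond under [h], because [u] is injective. *)
Lemma transfer_eqE (f g : I -> A) : injective u ->
  clJ (u \o f \o h) = clJ (u \o g \o h) <->
  UJ (h @^-1` [set i | f i = g i]).
Proof.
move=> u_inj; rewrite ultra_classP.
suff -> : [set j | (u \o f \o h) j = (u \o g \o h) j] =
          h @^-1` [set i | f i = g i] by [].
by apply/seteqP; split=> j /= => [/u_inj | ->].
Qed.

Definition transfer (x : AI) : BJ := clJ (u \o ultra_repr x \o h).

Lemma transfer_class (f : I -> A) : injective u ->
  (forall X, UI X -> UJ (h @^-1` X)) ->
  transfer (clI f) = clJ (u \o f \o h).
Proof.
move=> u_inj hU; apply/(transfer_eqE _ _ u_inj); apply: hU.
exact: ultra_class_repr.
Qed.

Lemma transfer_embedding : is_embedding u ->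
  (forall X, UI X <-> UJ (h @^-1` X)) -> is_embedding transfer.
Proof.
move=> [u_inj u_const u_op u_rel] hU; split.
- move=> x y /(transfer_eqE _ _ u_inj) /hU xy.
  by rewrite -(ultra_reprK x) -(ultra_reprK y); apply/ultra_classP.
- move=> c; rewrite /= transfer_class // => [|X /hU //].
  by congr (clJ _); apply/funext => j /=.
- move=> F x y /hU xy; apply/ultra_opE.
  by apply: filterS xy => j; apply: u_op.
- move=> R x.
  have [to_B of_B] := ultra_relE UJ_ultra (fun k => u \o ultra_repr (x k) \o h).
  split=> [/hU Rx | /to_B Rx].
    by apply: of_B; apply: filterS Rx => j /u_rel.
  by apply/hU; apply: filterS Rx => j /u_rel.
Qed.

(** Once [A] has two points, every index set is an equalizer, so equality of
    classes detects whether it is large; an injective map preserves and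
    reflects this equality. *)
Lemma transfer_injective_filter (e : AI -> BJ) :
  (exists a b : A, a <> b) -> injective u -> injective e ->
  (forall f, e (clI f) = clJ (u \o f \o h)) ->
  forall X, UI X <-> UJ (h @^-1` X).
Proof.
move=> [a [b ab]] u_inj e_inj eE X.
pose f i := if `[< X i >] then a else b.
have XE : X = [set i | f i = a].
  by apply/seteqP; split=> i; rewrite /f /=; case: asboolP => // _ /esym.
rewrite XE -(transfer_eqE f (fun=> a) u_inj) -!eE -ultra_classP.
by split=> [-> | /e_inj].
Qed.

End Transfer.

Theorem theorem2p10 (s : signature) (A B : structure s)
  (A_gt1 : exists a b : A, a <> b)
  (u : A -> B) (u_emb : is_embedding u)
  (I J : Type) (h : J -> I)
  (UI : set_system I) (UI_ultra : UltraFilter UI)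
  (UJ : set_system J) (UJ_ultra : UltraFilter UJ) :
  (forall f : I -> A, exists! g : J -> B, transfer_spec u h f g) /\
  (forall w : (I -> A) -> (J -> B),
     (forall f, transfer_spec u h f (w f)) ->
     ((exists e : ultrapower A UI_ultra -> ultrapower B UJ_ultra,
         (forall f, e (ultra_class UI_ultra f) = ultra_class UJ_ultra (w f)) /\
         is_embedding e)
      <->
      (forall X : set I, UI X <-> UJ (h @^-1` X)))).
Proof.
have [u_inj _ _ _] := u_emb.
split=> [f | w wP].
  exists (u \o f \o h); split; first exact/transfer_specE.
  by move=> g /(transfer_specE _ _ _ u_inj).
have wE f : w f = u \o f \o h by apply/transfer_specE.
split=> [[e [eE [e_inj _ _ _]]] | hU].
  apply: transfer_injective_filter A_gt1 u_inj e_inj _ => f.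
  by rewrite eE wE.
exists (transfer u h UJ_ultra); split; last exact: transfer_embedding.
by move=> f; rewrite wE transfer_class // => X /hU.
Qed.
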